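(* Let $n>0$ be an integer, written as $n=2^k+r$ with integers $k\ge 0$ and $0\le r<2^k$, and also as $n=2^k(1+x)$ with $x$ a dyadic rational, $0\le x<1$. Let $S_1(n)=\sum_{i=0}^{n-1}s_1(i)$, where $s_1(i)$ is the Hamming weight of $i$, and let $\delta(n)$ be the number of $D$-nodes in a divide-and-conquer tree on $n$ leaves. Then 1. $S_1(n)=\frac12\left(nk+2^k\,(2x-\tau(x))\right)$, 2. $S_1(n)=\frac12\left(nk+2r-2^k\,\tau\left(\frac{r}{2^k}\right)\right)$, and 3. $S_1(n)=\frac12\left(nk+2r-\delta(n)\right)$.
   Context: The Hamming weight $s_1(i)$ is the number of $1$s in the binary expansion of $i$ (so $s_1(0)=0$). A full binary tree is a rooted binary tree in which every interior node has exactly two children. An interior node of a full binary tree is an $S$-node if its two subtrees have the same number of leaves, and a $D$-node if its two subtrees have different numbers of leaves. A divide-and-conquer tree is a full binary tree in which the numbers of leaf descendants of the left and right children of any interior node differ by at most $1$ (a child that is a leaf counts as having one leaf). For each $n\ge 1$ there is exactly one such tree with $n$ leaves up to tree isomorphism. $\tau$ denotes the Takagi function on $[0,1]$, a continuous function. On dyadic rationals it is given as follows: for integers $k\ge 0$ and $0\le N<2^{k+1}$ with binary digits $N=\sum_{i=0}^{k}N_i2^i$, $N_i\in\{0,1\}$, and $N_i=0$ for every negative integer $i$, $\tau\left(\frac{N}{2^{k+1}}\right)=\sum_{i=1}^\infty \frac{\ell_i(N)}{2^i}$, where for $i\ge 0$, $\ell_{i+1}(N)=\sum_{j=0}^{i-1}N_{k-j}$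 if $N_{k-i}=0$, and $\ell_{i+1}(N)=i-\sum_{j=0}^{i-1}N_{k-j}$ if $N_{k-i}=1$. (Equivalently, $\tau(x)=\sum_{m=0}^\infty 2^{-m}\,\mathrm{dist}(2^m x,\mathbb{Z})$ for $x\in[0,1]$.) *)

(* Defs.v *)
From mathcomp Require Import all_boot all_order all_algebra.
From mathcomp Require Import all_classical all_reals all_analysis.
From mathcomp Require Import ring lra zify.

Set Implicit Arguments.
Unset Strict Implicit.
Unset Printing Implicit Defensive.

Import Order.TTheory GRing.Theory Num.Theory.
Import numFieldNormedType.Exports.

Local Open Scope classical_set_scope.
Local Open Scope ring_scope.

(* [odd (i %/ 2 ^ j)] is the binary digit of weight 2 ^ j of [i]; since
   i < 2 ^ i, the digits of weight 2 ^ j with i <= j all vanish. *)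
Definition hamming_weight (i : nat) : nat := (\sum_(j < i) odd (i %/ 2 ^ j))%N.

Definition S1 (n : nat) : nat := (\sum_(i < n) hamming_weight i)%N.

Inductive full_btree : Type :=
  | Leaf
  | Node of full_btree & full_btree.

Fixpoint leaves (t : full_btree) : nat :=
  if t is Node l r then (leaves l + leaves r)%N else 1%N.

Fixpoint D_nodes (t : full_btree) : nat :=
  if t is Node l r
  then ((leaves l != leaves r) + D_nodes l + D_nodes r)%N else 0%N.

Fixpoint divide_and_conquer (t : full_btree) : bool :=
  if t is Node l r
  then [&& (leaves l <= (leaves r).+1)%N, (leaves r <= (leaves l).+1)%N,
           divide_and_conquer l & divide_and_conquer r]
  else true.

Lemma divide_and_conquer_exists (n : nat) : (0 < n)%N ->
  exists2 t, divide_and_conquer t & leaves t = n.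
Proof.
elim/ltn_ind: n => n IH n0.
have [n1|n1] := leqP n 1; first by exists Leaf => //=; lia.
have [||l dl el] := IH n./2; [lia|lia|].
have [||r dr er] := IH (uphalf n); [lia|lia|].
exists (Node l r) => /=; last by rewrite el er; lia.
by rewrite dl dr el er !andbT; lia.
Qed.

Definition dyadic (R : realType) (x : R) : Prop :=
  exists (a : int) (m : nat), x = a%:~R / 2 ^+ m.

(* For x >= 0, the binary digit of weight 2 ^ - (j + 1) of [x]; a dyadic
   rational gets its finite expansion. *)
Definition frac_bit (R : realType) (x : R) (j : nat) : bool :=
  odd (Num.truncn (2 ^+ j.+1 * x)).

(* For x = N / 2 ^ (k + 1), [frac_bit x j] is the digit N_(k - j) of N, with
   N_i = 0 for i < 0. *)
Lemma frac_bit_dyadic (R : realType) (k N j : nat) :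
  frac_bit (N%:R / 2 ^+ k.+1 : R) j
  = if (j <= k)%N then odd (N %/ 2 ^ (k - j))%N else false.
Proof.
rewrite /frac_bit; case: leqP => jk.
  have -> : k.+1 = (j.+1 + (k - j))%N by lia.
  congr (odd _); apply: truncn_def.
  have p0 : 0 < 2 ^+ (k - j) :> R by rewrite exprn_gt0.
  have -> : 2 ^+ j.+1 * (N%:R / 2 ^+ (j.+1 + (k - j))) = N%:R / 2 ^+ (k - j) :> R.
    rewrite exprD; field; rewrite !expf_neq0//.
  rewrite ler_pdivlMr// ltr_pdivrMr// -natrX -!natrM ler_nat ltr_nat.
  by rewrite leq_divM/= -ltn_divLR ?expn_gt0.
have -> : j.+1 = (k.+1 + (j - k.+1).+1)%N by lia.
have -> : 2 ^+ (k.+1 + (j - k.+1).+1) * (N%:R / 2 ^+ k.+1)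
    = (2 ^ (j - k.+1).+1 * N)%:R :> R.
  by rewrite exprD natrM natrX; field; rewrite expf_neq0.
by rewrite natrK expnS -mulnA oddM.
Qed.

(* [ell x i] is l_(i + 1): the number of the first [i] binary digits of [x]
   that differ from the next one. *)
Definition ell (R : realType) (x : R) (i : nat) : nat :=
  let s := (\sum_(j < i) frac_bit x j)%N in
  if frac_bit x i then (i - s)%N else s.

(* Indices are shifted by one: this is \sum_(i >= 1) l_i / 2 ^ i. *)
Definition takagi (R : realType) (x : R) : R :=
  limn (series (fun i => (ell x i)%:R / 2 ^+ i.+1 : R)).

Definition dist_int (R : realType) (y : R) : R :=
  Num.min (y - (Num.floor y)%:~R) ((Num.floor y + 1)%:~R - y).

Section TakagiSeries.
Variables (R : realType) (x : R).
Hypothesis x01 : 0 <= x <= 1.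

Let t (m : nat) : nat := Num.truncn (2 ^+ m * x).
Let y (m : nat) : R := 2 ^+ m * x - (t m)%:R.
Let b := frac_bit x.
Let d (m : nat) : R := dist_int (2 ^+ m * x).

Let y_itv m : 0 <= y m < 1.
Proof.
have /andP[x0 _] := x01.
have /truncn_itv/andP[] : 0 <= 2 ^+ m * x by rewrite mulr_ge0 ?exprn_ge0.
by rewrite -/(t m) -addn1 natrD /y; lra.
Qed.

Let tS m : t m.+1 = (2 * t m + (1 <= 2 * y m)%R)%N.
Proof.
have := y_itv m; apply: contraTeq => /eqP h; apply/negP => ym; apply: h.
apply: truncn_def; rewrite exprS -mulrA -[(2 * t m + _).+1]addn1.
rewrite !(natrD, natrM); move: ym; rewrite /y.
by case: (leP 1 (2 * _)) => /= ?; lra.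
Qed.

Let bE m : b m = (1 <= 2 * y m).
Proof. by rewrite /b /frac_bit -/(t m.+1) tS oddD oddM/=; case: (1 <= _). Qed.

Let yS m : y m.+1 = 2 * y m - (b m)%:R.
Proof. by rewrite bE {1}/y tS natrD natrM exprS /y; ring. Qed.

Let dE m : d m = if b m then 1 - y m else y m.
Proof.
have fE : Num.floor (2 ^+ m * x) = (t m)%:Z.
  by apply: floor_def; rewrite intrD -!pmulrn; have := y_itv m; rewrite /y; lra.
rewrite /d /dist_int fE intrD -!pmulrn bE.
have -> : (t m)%:R + 1 - 2 ^+ m * x = 1 - y m by rewrite /y; ring.
rewrite -/(y m); case: (leP 1 (2 * _)) => h; first by rewrite min_r//; lra.
by rewrite min_l//; lra.
Qed.

Let sumb_le n : (\sum_(j < n) b j <= n)%N.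
Proof.
by rewrite -[leqRHS]card_ord -sum1_card leq_sum// => i _; case: (b i).
Qed.

Let u (i : nat) : R := (ell x i)%:R / 2 ^+ i.+1.
Let v (m : nat) : R := d m / 2 ^+ m.
Let e (n : nat) : R :=
  let c := (\sum_(j < n) b j)%:R in (c * (1 - y n) + (n%:R - c) * y n) / 2 ^+ n.

Let seriesB n : series v n - series u n = e n.
Proof.
elim: n => [|n IH].
  by rewrite /series/= !big_nat !big_pred0// /e big_ord0; lra.
rewrite !seriesSr.
have -> : series v n = series u n + e n by rewrite -IH; ring.
rewrite /e big_ord_recr/= yS /v dE /u /ell -/b -[n.+1]addn1 !natrD.
have := sumb_le n; case: (b n) => /= cn; rewrite ?natrB// exprD expr1;
  by field; rewrite expf_neq0.
Qed.

Let pow2_ge n : (n.+1 ^ 2 <= 4 * 2 ^ n)%N.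
Proof.
elim: n => [//|[//|[//|n]] IH].
by rewrite [(2 ^ n.+3)%N]expnS; move: IH; rewrite -!mulnn; nia.
Qed.

Let e_cvg0 : e n @[n --> \oo] --> 0.
Proof.
have h : 4 * harmonic n @[n --> \oo] --> (0 : R).
  by rewrite -[X in _ --> X](mulr0 4); apply: cvgM; [exact: cvg_cst|exact: cvg_harmonic].
apply: (squeeze_cvgr _ (cvg_cst 0) h); near=> n.
have p0 : 0 < 2 ^+ n :> R by rewrite exprn_gt0.
have := y_itv n; have := sumb_le n; rewrite /e.
set c := (\sum_(j < n) b j)%N; rewrite -(ler_nat R) => cn yn.
have c0 : 0 <= c%:R :> R by [].
apply/andP; split => /=; first by rewrite divr_ge0 ?addr_ge0 ?mulr_ge0 ?(ltW p0)//; lra.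
rewrite ler_pdivrMr//=.
have /(_ n) := pow2_ge; rewrite -(ler_nat R) natrX natrM natrX => h2.
have q0 : 0 < n.+1%:R :> R by [].
apply: (@le_trans _ _ n.+1%:R).
  have : c%:R * (1 - y n) <= c%:R by rewrite ler_piMr//; lra.
  have : (n%:R - c%:R) * y n <= n%:R - c%:R by rewrite ler_piMr//; lra.
  by rewrite -[n.+1]addn1 natrD; lra.
rewrite mulrAC ler_pdivlMr//; by rewrite -expr2.
Unshelve. all: by end_near. Qed.

Let v_is_cvg : cvgn (series v).
Proof.
apply: (@series_le_cvg _ v (geometric 1 2^-1)).
- by move=> n; rewrite divr_ge0 ?exprn_ge0// dE; have := y_itv n; case: (b n); lra.
- by move=> n; rewrite /geometric/= mul1r exprVn invr_ge0 exprn_ge0.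
- move=> n; rewrite /geometric/= mul1r exprVn /v ler_piMl ?invr_ge0 ?exprn_ge0//.
  by rewrite dE; have := y_itv n; case: (b n); lra.
- by apply: is_cvg_geometric_series; rewrite ger0_norm; lra.
Qed.

Let u_cvg : series u n @[n --> \oo] --> limn (series v).
Proof.
have -> : series u = series v - e by apply/funext => n; rewrite !fctE -seriesB; ring.
by rewrite -[X in _ --> X]subr0; apply: cvgB.
Qed.

Lemma takagi_cvg :
  series (fun i => (ell x i)%:R / 2 ^+ i.+1 : R) n @[n --> \oo] --> takagi x.
Proof. by rewrite /takagi (cvg_lim _ u_cvg). Qed.

Lemma takagi_dist :
  series (fun m => dist_int (2 ^+ m * x) / 2 ^+ m) n @[n --> \oo] --> takagi x.
Proof. by rewrite /takagi (cvg_lim _ u_cvg). Qed.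

End TakagiSeries.

(* Main.v *)
Require Import Defs.
From mathcomp Require Import all_boot all_order all_algebra.
From mathcomp Require Import all_classical all_reals all_analysis.
From mathcomp Require Import ring lra zify.
Import Order.TTheory GRing.Theory Num.Theory.
Local Open Scope ring_scope.

(** All three parts come from one integer, the sum over 1 <= j <= k of the
    distance from n to the nearest multiple of 2 ^ j.

    - Binary digits: as n grows, the distance to the multiples of 2 ^ (j + 1)
      increases by 1 at each step where the digit of weight 2 ^ j is 0 and
      decreases by 1 where it is 1.  So n minus this distance is twice the
      number of i < n with that digit equal to 1 ([count_bit]).  Summing over
      the digits gives 2 S_1(n) ([S1_mult_dist]); the leading digit, whose
      distance is 2 ^ k - r, contributes n - (2 ^ k - r) = 2 r.
    - Trees: for even M, the distance to the multiples of M is affine between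
      consecutive integers and its breakpoints are integers, so the distance
      from a + b to the multiples of 2 M is the sum of the distances from a
      and b to those of M as soon as a and b differ by at most 1
      ([mult_dist_add]).  For M = 1 that rule fails exactly when a and b
      differ, that is, at a D-node.  Hence the sum of distances satisfies the
      recursion of the number of D-nodes ([D_nodes_mult_dist]).
    - Takagi function: in the series of the 2 ^ - m dist(2 ^ m x, Z) at
      x = r / 2 ^ k, the term m is 2 ^ - k times the distance from r to the
      multiples of 2 ^ (k - m) when m < k, and 0 otherwise
      ([takagi_mult_dist]).

    Since n = 2 ^ k + r, the numbers n and r are at the same distance from the
    multiples of 2 ^ j for j <= k; and x = r / 2 ^ k, which makes part 1 a
    rewriting of part 2. *)

(** * Distance to the nearest multiple *)

Definition mult_dist (M n : nat) : nat := minn (n %% M)%N (M - n %% M)%N.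

Lemma mult_dist_periodic M q n : mult_dist M (q * M + n) = mult_dist M n.
Proof. by rewrite /mult_dist modnMDl. Qed.

(** The distance to the multiples of 2 M is a triangular wave, of slope 1 on
    the first half of a period and -1 on the second half; for M a power of 2
    the parity of [n %/ M] is the binary digit that tells these halves apart. *)
Lemma mult_distS M n : (0 < M)%N ->
  (mult_dist (2 * M) n.+1 + 2 * odd (n %/ M) = (mult_dist (2 * M) n).+1)%N.
Proof.
move=> M0; rewrite (divn_eq n (2 * M)).
have : (n %% (2 * M) < 2 * M)%N by rewrite ltn_mod muln_gt0.
move: (n %/ _)%N (n %% _)%N => q s sM.
rewrite -addnS !mult_dist_periodic mulnA divnMDl// oddD oddM/= andbF/=.
rewrite /mult_dist (modn_small sM).
have [Ms|Ms] := leqP M s; last first.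
  by rewrite (divn_small Ms) modn_small/=; lia.
have -> : (s %/ M)%N = 1%N.
  by apply/eqP; rewrite eqn_leq -ltnS ltn_divLR// leq_divRL//; lia.
have [E|E] := eqVneq s.+1 (2 * M)%N; first by rewrite E modnn /=; lia.
by rewrite modn_small/=; lia.
Qed.

Lemma mult_dist_double M n : mult_dist (2 * M) (2 * n) = (2 * mult_dist M n)%N.
Proof. by rewrite /mult_dist -muln_modr -mulnBr minnMr. Qed.

(** When a and b are equal this is homogeneity.  When b = a + 1, the point
    2 a + 1 is the midpoint of 2 a and 2 a + 2, and 2 a, 2 a + 1 lie on the same
    slope because they have the same quotient by 2 M; so the distance at the
    midpoint is the mean of the two others, to which homogeneity applies. *)
Lemma mult_dist_add M a b : (0 < M)%N -> (a <= b.+1)%N -> (b <= a.+1)%N ->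
  mult_dist (2 * (2 * M)) (a + b)
  = (mult_dist (2 * M) a + mult_dist (2 * M) b)%N.
Proof.
move=> M0; wlog ab : a b / (a <= b)%N => [H ab ba|_ ba].
  have [/H|/ltnW/H] := leqP a b; first exact.
  by rewrite addnC => ->//; rewrite addnC.
have [->|E] := eqVneq b a; first by rewrite addnn -mul2n mult_dist_double; lia.
have {ba ab E}-> : b = a.+1 by lia.
have M20 : (0 < 2 * M)%N by lia.
have D := mult_dist_double (2 * M).
have := mult_distS (2 * M) (2 * a) M20; have := mult_distS (2 * M) (2 * a).+1 M20.
have -> : ((2 * a).+1 %/ (2 * M) = 2 * a %/ (2 * M))%N.
  by rewrite !divnMA; congr (_ %/ _)%N; lia.
have -> : (2 * a).+2 = (2 * a.+1)%N by lia.
have -> : (a + a.+1 = (2 * a).+1)%N by lia.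
rewrite !D; lia.
Qed.

Lemma mult_dist2 n : mult_dist 2 n = odd n.
Proof. by rewrite /mult_dist modn2; case: odd. Qed.

Lemma mult_dist1 n : mult_dist 1 n = 0%N.
Proof. by rewrite /mult_dist modn1 min0n. Qed.

(** * Digits and the summed Hamming weight *)

(** Each step of the triangular wave adds 1 minus twice the digit, so summing
    the steps from 0 to n leaves n minus twice the number of ones. *)
Lemma count_bit M n : (0 < M)%N ->
  (2 * (\sum_(i < n) odd (i %/ M)) + mult_dist (2 * M) n = n)%N.
Proof.
move=> M0; elim: n => [|n IH]; first by rewrite big_ord0 /mult_dist mod0n min0n.
have := mult_distS M n M0; rewrite big_ord_recr/=.
by move: (mult_dist _ _) (mult_dist _ _) (odd _ : nat) (\sum_(i < n) _)%N IH; lia.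
Qed.

(** Gives all numbers below 2 ^ K the same range of digits, so that the sums
    over numbers and over digits can be exchanged. *)
Lemma hamming_weightE K i : (i < 2 ^ K)%N ->
  hamming_weight i = (\sum_(j < K) odd (i %/ 2 ^ j))%N.
Proof.
have stable L L' : (i < 2 ^ L)%N -> (L <= L')%N ->
    (\sum_(j < L') odd (i %/ 2 ^ j) = \sum_(j < L) odd (i %/ 2 ^ j))%N.
  move=> iL LL'; rewrite -(subnKC LL') big_split_ord/= [X in (_ + X)%N]big1 ?addn0//.
  by move=> j _; rewrite divn_small// (leq_trans iL)// leq_exp2l// leq_addr.
move=> iK; rewrite /hamming_weight.
have [Ki|/ltnW iK'] := leqP K i; first exact: stable.
by rewrite (stable _ _ (ltn_expl i _) iK').
Qed.

(** Summation of [count_bit] over the k + 1 digits.  The digits below the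
    leading one give n k minus the distances; the leading one gives 2 r. *)
Lemma S1_mult_dist k r : (r < 2 ^ k)%N ->
  (2 * S1 (2 ^ k + r) + \sum_(j < k) mult_dist (2 ^ j.+1) (2 ^ k + r)
   = (2 ^ k + r) * k + 2 * r)%N.
Proof.
move=> rk; set n := (2 ^ k + r)%N.
have -> : S1 n = (\sum_(j < k.+1) \sum_(i < n) odd (i %/ 2 ^ j))%N.
  rewrite exchange_big; apply: eq_bigr => i _; apply: hamming_weightE.
  by rewrite expnS (leq_trans (ltn_ord i))// /n; lia.
have top : mult_dist (2 * 2 ^ k) n = (2 ^ k - r)%N.
  by rewrite /mult_dist modn_small /n; lia.
have := count_bit (2 ^ k) n; rewrite expn_gt0 top => /(_ isT) topE.
have : (\sum_(j < k) (2 * (\sum_(i < n) odd (i %/ 2 ^ j)) + mult_dist (2 ^ j.+1) n)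
    = k * n)%N.
  rewrite -[X in (X * _)%N]card_ord -sum_nat_const; apply: eq_bigr => j _.
  by rewrite expnS count_bit// expn_gt0.
rewrite big_split/= -big_distrr/= big_ord_recr/= /n in topE *; lia.
Qed.

(** * Counting D-nodes *)

(** Both ends of the range for the number of leaves are included because at
    2 ^ k either choice of exponent gives 0; this makes the range pass from a
    node to both of its children even when one of them has 2 ^ k leaves. *)
Lemma D_nodes_mult_dist t k : divide_and_conquer t ->
  (2 ^ k <= leaves t <= 2 ^ k.+1)%N ->
  D_nodes t = (\sum_(j < k) mult_dist (2 ^ j.+1) (leaves t))%N.
Proof.
have leaves_gt0 s : (0 < leaves s)%N by elim: s => //= l; lia.
elim: t k => [|l IHl r IHr] [|k] /=; rewrite ?big_ord0//.
- by have := expn_gt0 2 k; rewrite expnS; lia.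
- case/and4P=> lr rl dl dr /andP[_ n2].
  have l0 := leaves_gt0 l; have r0 := leaves_gt0 r.
  by rewrite (IHl 0%N)// ?(IHr 0%N)// ?big_ord0; lia.
case/and4P=> lr rl dl dr n_itv.
rewrite (IHl k)// ?(IHr k)//; try (rewrite !expnS in n_itv *; lia).
(* The modulus 2 detects a D-node; each larger modulus splits between the
   two children with the modulus halved. *)
rewrite big_ord_recl/= mult_dist2 -addnA -big_split/=; congr (_ + _)%N; first by lia.
by apply: eq_bigr => j _; rewrite [in RHS]expnS expnS mult_dist_add ?expn_gt0.
Qed.

(** * The Takagi function at dyadic points *)

Section Takagi.
Variable R : realType.

Lemma dist_int_mult_dist M a : (0 < M)%N ->
  dist_int (a%:R / M%:R : R) = (mult_dist M a)%:R / M%:R.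
Proof.
move=> M0; have M0' : 0 < M%:R :> R by rewrite ltr0n.
have sM := ltn_pmod a M0.
have aE : a%:R / M%:R = (a %/ M)%:R + (a %% M)%:R / M%:R :> R.
  by rewrite {1}(divn_eq a M) natrD natrM mulrDl mulfK// gt_eqF.
have s0 : 0 <= (a %% M)%:R / M%:R :> R by rewrite divr_ge0.
have s1 : (a %% M)%:R / M%:R < 1 :> R by rewrite ltr_pdivrMr// mul1r ltr_nat.
have fE : Num.floor (a%:R / M%:R : R) = (a %/ M)%N%:Z.
  by apply: floor_def; rewrite intrD -!pmulrn aE; lra.
rewrite /dist_int fE intrD -!pmulrn /mult_dist natr_min natrB ?(ltnW sM)//.
rewrite minr_pMl ?invr_ge0 ?ltW//; congr Num.min; rewrite aE; first by ring.
by rewrite mulrBl divff ?gt_eqF//; ring.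
Qed.

(** The series of [takagi_dist] is a finite sum at r / 2 ^ k: once m >= k, the
    number 2 ^ m r / 2 ^ k is an integer. *)
Lemma takagi_mult_dist k r : (r < 2 ^ k)%N ->
  2 ^+ k * takagi (r%:R / 2 ^+ k : R)
  = (\sum_(j < k) mult_dist (2 ^ j.+1) r)%:R.
Proof.
move=> rk; have p0 m : 0 < 2 ^+ m :> R by rewrite exprn_gt0.
set x : R := r%:R / 2 ^+ k.
have x01 : 0 <= x <= 1.
  by rewrite /x divr_ge0 ?exprn_ge0//= ler_pdivrMr// mul1r -natrX ler_nat ltnW.
suff -> : takagi x = (\sum_(j < k) mult_dist (2 ^ j.+1) r)%:R / 2 ^+ k.
  by rewrite mulrC divfK// gt_eqF.
rewrite -(cvg_lim (@norm_hausdorff R R) (takagi_dist x01)).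
apply: (lim_near_cst (@norm_hausdorff R R)); near=> n.
have kn : (k <= n)%N by near: n; exact: nbhs_infty_ge.
rewrite /series/= big_mkord -(subnKC kn) big_split_ord/=.
rewrite [X in _ + X]big1 ?addr0 => [|j _]; last first.
  have -> : 2 ^+ (k + j) * x = (2 ^ j * r)%:R / 1%:R :> R.
    by rewrite exprD natrM natrX /x; field; rewrite gt_eqF.
  by rewrite dist_int_mult_dist// mult_dist1 !mul0r.
(* The term of index m of the series matches the modulus 2 ^ (k - m), so the
   order of summation is reversed. *)
rewrite natr_sum mulr_suml (reindex_inj rev_ord_inj); apply: eq_bigr => j _ /=.
have kE : 2 ^+ k = 2 ^+ (k - j.+1) * 2 ^+ j.+1 :> R by rewrite -exprD subnK.
have -> : 2 ^+ (k - j.+1) * x = r%:R / (2 ^ j.+1)%:R.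
  by rewrite /x natrX kE; field; rewrite !gt_eqF.
rewrite dist_int_mult_dist ?expn_gt0// natrX kE.
by field; rewrite !gt_eqF.
Unshelve. all: by end_near. Qed.

End Takagi.

(** * The three formulas *)

Theorem corollary31 (R : realType) (n k r : nat) (x : R)
    (n_gt0 : (0 < n)%N)
    (r_lt : (r < 2 ^ k)%N) (nE : n = (2 ^ k + r)%N)
    (x_dyadic : dyadic x) (x_itv : 0 <= x < 1)
    (nxE : n%:R = 2 ^+ k * (1 + x)) :
  [/\ (S1 n)%:R = 2^-1 * ((n * k)%:R + 2 ^+ k * (2 * x - takagi x)),
      (S1 n)%:R
        = 2^-1 * ((n * k)%:R + 2 * r%:R - 2 ^+ k * takagi (r%:R / 2 ^+ k : R))
    & forall t : full_btree, divide_and_conquer t -> leaves t = n ->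
      (S1 n)%:R = 2^-1 * ((n * k)%:R + 2 * r%:R - (D_nodes t)%:R) :> R].
Proof.
have p0 : 2 ^+ k != 0 :> R by rewrite expf_neq0.
have xE : x = r%:R / 2 ^+ k.
  apply: (mulfI p0); rewrite mulrC [RHS]mulrC divfK//.
  by move: nxE; rewrite nE natrD natrX; lra.
have n_itv : (2 ^ k <= n <= 2 ^ k.+1)%N by rewrite nE expnS; lia.
have dist_n : (\sum_(j < k) mult_dist (2 ^ j.+1) n
    = \sum_(j < k) mult_dist (2 ^ j.+1) r)%N.
  apply: eq_bigr => j _.
  have kE : (2 ^ k = 2 ^ (k - j.+1) * 2 ^ j.+1)%N by rewrite -expnD subnK.
  by rewrite nE kE mult_dist_periodic.
have S1E := S1_mult_dist k r r_lt; rewrite -nE in S1E.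
have {S1E} S1E (D : nat) : D = (\sum_(j < k) mult_dist (2 ^ j.+1) n)%N ->
    (S1 n)%:R = 2^-1 * ((n * k)%:R + 2 * r%:R - D%:R) :> R.
  move=> ->; have := congr1 (fun m => m%:R : R) S1E.
  by rewrite !mul2n -!addnn !natrD; lra.
have part2 : (S1 n)%:R
    = 2^-1 * ((n * k)%:R + 2 * r%:R - 2 ^+ k * takagi (r%:R / 2 ^+ k : R)).
  by rewrite takagi_mult_dist//; apply: S1E.
split=> [||t dt tn]; last 1 first.
- by apply: S1E; rewrite (D_nodes_mult_dist t k)// tn.
- rewrite part2 -xE; have <- : 2 ^+ k * x = r%:R by rewrite xE mulrC divfK.
  by ring.
- exact: part2.
Qed.
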